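(* Let $q$ be a prime power and let $k\ge 3$, $t\ge 1$, $h\ge 0$ be integers with $t+h\le k-1$ and $k>\frac{q-t+1}{2}$. Then there is no self-orthogonal generalized twisted Reed-Solomon code over $\mathbb{F}_q$ with dimension $k$, hook $h$ and twist $t$; that is, for every $n$ with $k+t\le n\le q$, every $\eta\in\mathbb{F}_q^*$, every $\boldsymbol{\alpha}\in\mathbb{F}_q^n$ with pairwise distinct entries and every $\boldsymbol{v}\in(\mathbb{F}_q^* )^n$, the code $\mathcal{C}_{\mathcal{V}_{k,t,h,\eta}}(\boldsymbol{\alpha},\boldsymbol{v})$ is not self-orthogonal.
   Context: For $0\le h\le k-1$, $t\ge1$ and $\eta\in\mathbb{F}_q^*=\mathbb{F}_q\setminus\{0\}$ put $$\mathcal{V}_{k,t,h,\eta}=\Big\{\sum_{i=0}^{k-1}a_ix^i+\eta a_hx^{k-1+t}\ \Big|\ a_0,\ldots,a_{k-1}\in\mathbb{F}_q\Big\}.$$ For $k+t\le n\le q$, $\boldsymbol{\alpha}=(\beta_1,\ldots,\beta_n)$ with pairwise distinct entries in $\mathbb{F}_q$, and $\boldsymbol{v}=(v_1,\ldots,v_n)\in(\mathbb{F}_q^* )^n$, the generalized twisted Reed-Solomon (GTRS) code with dimension $k$, hook $h$ and twist $t$ is $$\mathcal{C}_{\mathcal{V}_{k,t,h,\eta}}(\boldsymbol{\alpha},\boldsymbol{v})=\{(v_1f(\beta_1),\ldots,v_nf(\beta_n))\mid f\in\mathcal{V}_{k,t,h,\eta}\}.$$ A linear code $\mathcal{C}\subseteq\mathbb{F}_q^n$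 is self-orthogonal if $\mathcal{C}\subseteq\mathcal{C}^\perp$ with respect to the Euclidean inner product. *)

(* Defs.v *)
From HB Require Import structures.
From mathcomp Require Import all_boot all_order all_algebra.
From mathcomp Require Import classical_sets.

Set Implicit Arguments.
Unset Strict Implicit.
Unset Printing Implicit Defensive.

Import Order.TTheory GRing.Theory Num.Theory.

Local Open Scope classical_set_scope.
Local Open Scope ring_scope.

(* The index type 'I_k of the hook enforces 0 <= h <= k - 1; in particular
   k > 0, so the truncated predecessor in the exponent k - 1 + t is harmless. *)
Definition twisted_polys (F : finFieldType) (k t : nat) (h : 'I_k) (eta : F) :
    set {poly F} :=
  [set f | exists a : 'rV[F]_k,
    f = \sum_(i < k) a 0 i *: 'X^i + (eta * a 0 h) *: 'X^(k - 1 + t)].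

Definition eval_word (F : finFieldType) (n : nat) (alpha v : 'rV[F]_n)
    (f : {poly F}) : 'rV[F]_n :=
  \row_(i < n) (v 0 i * f.[alpha 0 i]).

Definition gtrs_code (F : finFieldType) (n k t : nat) (h : 'I_k) (eta : F)
    (alpha v : 'rV[F]_n) : set 'rV[F]_n :=
  eval_word alpha v @` twisted_polys t h eta.

Definition dual_code (F : finFieldType) (n : nat) (C : set 'rV[F]_n) :
    set 'rV[F]_n :=
  [set y | forall c, C c -> \sum_(i < n) c 0 i * y 0 i = 0].

Definition self_orthogonal (F : finFieldType) (n : nat) (C : set 'rV[F]_n) :
    Prop :=
  C `<=` dual_code C.

(* Main.v *)
(** Write m_s = sum_i v_i^2 alpha_i^s, and let q be the order of the field.
    Self-orthogonality of the code says that the linear functional x^s |-> m_s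
    kills all products of two elements of the twisted space. It also forces
    2k <= n, so that 2k <= q <= 2k + t - 2, whence t >= 2 and h + 3 <= k. Then
    every s in [2, 2k-2] is a sum of two exponents below k that avoid h, so that
    m_s = 0; the relations m_(i+h) + eta m_(i+k-1+t) = 0 for i <> h extend this
    to all of [1, q], using m_q = m_1 in the extremal case h = 0, t = k - 1.
    As there are at most q evaluation points, all weights v_i^2 at nonzero
    points would then vanish. *)
Require Import Defs.
From HB Require Import structures.
From mathcomp Require Import all_boot all_order all_algebra.
From mathcomp Require Import finfield zify ring lra.
From mathcomp Require Import classical_sets.

Set Implicit Arguments.
Unset Strict Implicit.
Unset Printing Implicit Defensive.

Import Order.TTheory GRing.Theory Num.Theory.

Local Open Scope ring_scope.

Definition moment (F : finFieldType) (n : nat) (alpha v : 'rV[F]_n) (s : nat) : F :=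
  \sum_(j < n) v 0 j ^+ 2 * alpha 0 j ^+ s.

(** The standard basis of the twisted space, one element for each unit coefficient vector. *)
Definition twisted_monomial (F : finFieldType) (k t : nat) (h : 'I_k) (eta : F)
    (i : 'I_k) : {poly F} :=
  'X^i + (eta * (i == h)%:R) *: 'X^(k - 1 + t).

Lemma twisted_monomial_mem (F : finFieldType) (k t : nat) (h : 'I_k) (eta : F)
    (i : 'I_k) : twisted_polys t h eta (twisted_monomial t h eta i).
Proof.
exists (delta_mx 0 i); rewrite /twisted_monomial mxE eqxx eq_sym /=; congr (_ + _).
rewrite (bigD1 i) //= mxE !eqxx scale1r big1 ?addr0 // => j ji.
by rewrite mxE (negbTE ji) andbF scale0r.
Qed.

Lemma size_twisted_monomial (F : finFieldType) (k t : nat) (h : 'I_k) (eta : F)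
    (i : 'I_k) : (size (twisted_monomial t h eta i) <= k + t)%N.
Proof.
have ik := ltn_ord i.
apply: (leq_trans (size_polyD _ _)); rewrite geq_max size_polyXn.
apply/andP; split; first lia.
by apply: (leq_trans (size_scale_leq _ _)); rewrite size_polyXn; lia.
Qed.

Lemma coef_twisted_monomial (F : finFieldType) (k t : nat) (h : 'I_k) (eta : F)
    (i l : 'I_k) : (0 < t)%N -> (twisted_monomial t h eta i)`_l = (l == i)%:R.
Proof.
move=> t0; have lk := ltn_ord l.
rewrite coefD coefZ !coefXn.
have -> : (l == k - 1 + t :> nat)%N = false by apply/negbTE; lia.
by rewrite mulr0 addr0.
Qed.

Lemma moment_card (F : finFieldType) (n : nat) (alpha v : 'rV[F]_n) :
  moment alpha v #|F| = moment alpha v 1.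
Proof. by rewrite /moment; apply: eq_bigr => j _; rewrite expf_card expr1. Qed.

(** Test against [x * g(x)], where [g] vanishes at every evaluation point except one nonzero
    [alpha 0 i]. Only exponents 1 to [n] occur, so vanishing moments kill the sum, yet its single
    surviving term is a product of nonzero factors. *)
Lemma all_moments_eq0 (F : finFieldType) (n : nat) (alpha v : 'rV[F]_n) :
  (1 < n)%N -> injective (fun i : 'I_n => alpha 0 i) ->
  (forall i : 'I_n, v 0 i != 0) ->
  ~ (forall s, (0 < s <= n)%N -> moment alpha v s = 0).
Proof.
move=> n1 ainj v0 m0.
have [i ai] : exists i, alpha 0 i != 0.
  have [a0|a0] := eqVneq (alpha 0 (Ordinal (ltnW n1))) 0; last by eexists; exact: a0.
  exists (Ordinal n1); apply/eqP => a1.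
  by have := ainj (Ordinal (ltnW n1)) (Ordinal n1); rewrite /= a0 a1 => /(_ erefl).
pose g : {poly F} := \prod_(j < n | j != i) ('X - (alpha 0 j)%:P).
have sg : (size g <= n)%N.
  rewrite /g -big_filter size_prod_XsubC -cardE cardC1 card_ord; lia.
have : \sum_(j < n) v 0 j ^+ 2 * (alpha 0 j * g.[alpha 0 j]) = 0.
  under eq_bigr => j _ do rewrite (horner_coef_wide _ sg) !mulr_sumr.
  rewrite exchange_big big1 //= => s _.
  transitivity (g`_s * moment alpha v s.+1); last by rewrite m0 ?mulr0 ?ltn_ord.
  rewrite mulr_sumr.
  by apply: eq_bigr => j _; rewrite [_ ^+ s.+1]exprS [alpha 0 j * _]mulrCA; exact: mulrCA.
rewrite (bigD1 i) //= big1 ?addr0 => [|j ji]; last first.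
  by rewrite /g horner_prod (bigD1 j) //= hornerXsubC subrr mul0r !mulr0.
apply/eqP; rewrite !mulf_neq0 ?expf_neq0 //.
rewrite /g horner_prod prodf_seq_neq0; apply/allP => j _; apply/implyP => ji.
rewrite hornerXsubC subr_eq0; apply/eqP => /ainj ij.
by rewrite ij eqxx in ji.
Qed.

Lemma self_orthogonal_twisted_monomial (F : finFieldType) (n k t : nat) (h : 'I_k)
    (eta : F) (alpha v : 'rV[F]_n) (i j : 'I_k) :
  self_orthogonal (gtrs_code t h eta alpha v) ->
  \sum_(l < n) (v 0 l * (twisted_monomial t h eta i).[alpha 0 l])
    * (v 0 l * (twisted_monomial t h eta j).[alpha 0 l]) = 0.
Proof.
move=> so.
have mem i' : gtrs_code t h eta alpha v
    (eval_word alpha v (twisted_monomial t h eta i')).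
  by exists (twisted_monomial t h eta i') => //; exact: twisted_monomial_mem.
rewrite -[RHS](so _ (mem j) _ (mem i)).
by apply: eq_bigr => l _; rewrite !mxE.
Qed.

(** A generator matrix [G] satisfies [G *m G^T = 0] and has rank [k]: a twisted polynomial has
    degree below [k + t <= n], so it cannot vanish at [n] distinct points unless it is zero. *)
Lemma self_orthogonal_dim (F : finFieldType) (n k t : nat) (h : 'I_k)
    (eta : F) (alpha v : 'rV[F]_n) :
  (0 < t)%N -> (k + t <= n)%N -> injective (fun i : 'I_n => alpha 0 i) ->
  (forall i : 'I_n, v 0 i != 0) ->
  self_orthogonal (gtrs_code t h eta alpha v) -> (2 * k <= n)%N.
Proof.
move=> t0 ktn ainj v0 so.
pose G := \matrix_(i < k, j < n) (v 0 j * (twisted_monomial t h eta i).[alpha 0 j]).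
have GG : G *m G^T = 0.
  apply/matrixP => i j; rewrite !mxE -[RHS](self_orthogonal_twisted_monomial i j so).
  by apply: eq_bigr => l _; rewrite !mxE.
have rG : row_free G.
  apply: inj_row_free => u uG.
  pose f := \sum_(i < k) u 0 i *: twisted_monomial t h eta i.
  have sf : (size f <= k + t)%N.
    apply: (leq_trans (size_sum _ _ _)); apply/bigmax_leqP => i _.
    exact: leq_trans (size_scale_leq _ _) (size_twisted_monomial _ _ _ _).
  have f0 : f = 0.
    apply: (@roots_geq_poly_eq0 _ _ [seq alpha 0 j | j <- enum 'I_n]).
    - apply/allP => _ /mapP[j _ ->]; apply/eqP.
      have := congr1 (fun A : 'rV_n => A 0 j) uG; rewrite !mxE => uGj.
      apply: (mulfI (v0 j)); rewrite mulr0 -[RHS]uGj /f horner_sum mulr_sumr.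
      by apply: eq_bigr => i _; rewrite hornerZ mxE mulrCA.
    - by rewrite map_inj_uniq ?enum_uniq.
    - by rewrite size_map size_enum_ord (leq_trans sf).
  (* Since [t > 0], the twist sits in degree at least [k], so the coefficients of [f] below [k] are
     exactly the entries of [u]. *)
  apply/rowP => l; rewrite mxE -[RHS](coef0 F l) -f0 /f coef_sum.
  rewrite (bigD1 l) //= coefZ coef_twisted_monomial // eqxx mulr1 big1 ?addr0 // => i il.
  by rewrite coefZ coef_twisted_monomial // eq_sym (negbTE il) mulr0.
have := mulmx0_rank_max GG; rewrite mxrank_tr (eqP rG); lia.
Qed.

Lemma self_orthogonal_moment (F : finFieldType) (n k t : nat) (h : 'I_k)
    (eta : F) (alpha v : 'rV[F]_n) (i j : nat) :
  self_orthogonal (gtrs_code t h eta alpha v) ->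
  (i < k)%N -> (j < k)%N -> i != h -> j != h -> moment alpha v (i + j) = 0.
Proof.
move=> so ik jk ih jh.
rewrite -[RHS](self_orthogonal_twisted_monomial (Ordinal ik) (Ordinal jk) so).
apply: eq_bigr => l _; rewrite /twisted_monomial -!val_eqE /= (negbTE ih) (negbTE jh).
by rewrite !mulr0 !scale0r !addr0 !hornerXn mulrACA exprD expr2.
Qed.

Lemma self_orthogonal_moment_hook (F : finFieldType) (n k t : nat) (h : 'I_k)
    (eta : F) (alpha v : 'rV[F]_n) (i : nat) :
  self_orthogonal (gtrs_code t h eta alpha v) ->
  (i < k)%N -> i != h ->
  moment alpha v (i + h) + eta * moment alpha v (i + (k - 1 + t)) = 0.
Proof.
move=> so ik ih.
rewrite -[RHS](self_orthogonal_twisted_monomial (Ordinal ik) h so).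
rewrite mulr_sumr -big_split; apply: eq_bigr => l _.
rewrite /twisted_monomial -!val_eqE /= (negbTE ih) eqxx.
rewrite mulr0 scale0r addr0 mulr1 hornerD hornerZ !hornerXn mulrACA expr2.
by rewrite !exprD; ring.
Qed.

(** Split off 0 or [k - 1]; if a summand hits [h], move one unit between the two. The gap between
    [h] and [k] keeps the adjusted pair clear of the hook. *)
Lemma sum_avoiding_hook (k h s : nat) : (h + 3 <= k)%N -> (2 <= s <= 2 * k - 2)%N ->
  exists i j, [/\ (i < k)%N, (j < k)%N, i != h, j != h & s = (i + j)%N].
Proof.
move=> hk hs.
have [sk|sk] := ltnP s k.
  have [h0|h0] := eqVneq h 0%N; first by exists 1%N, (s - 1)%N; split; lia.
  have [sh|sh] := eqVneq s h; first by exists 1%N, (s - 1)%N; split; lia.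
  by exists 0%N, s; split; lia.
have [sh|sh] := eqVneq (s - (k - 1))%N h.
  by exists (h + 1)%N, (k - 2)%N; split; lia.
by exists (s - (k - 1))%N, (k - 1)%N; split; lia.
Qed.

Theorem corollary4p1 (F : finFieldType) (k t : nat) (h : 'I_k)
    (hk : (3 <= k)%N) (ht : (1 <= t)%N) (hth : (t + h <= k - 1)%N)
    (hq : (#|F|%:R - t%:R + 1) / 2%:R < k%:R :> rat) :
  forall (n : nat) (eta : F) (alpha v : 'rV[F]_n),
    (k + t <= n)%N -> (n <= #|F|)%N ->
    eta != 0 ->
    injective (fun i : 'I_n => alpha 0 i) ->
    (forall i : 'I_n, v 0 i != 0) ->
    ~ self_orthogonal (gtrs_code t h eta alpha v).
Proof.
move=> n eta alpha v ktn nq eta0 ainj v0 so.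
have kn := self_orthogonal_dim ht ktn ainj v0 so.
have qlt : (#|F| + 1 < 2 * k + t)%N.
  by rewrite -(ltr_nat rat) mul2n -addnn !natrD; lra.
set q := #|F| in nq qlt.
pose m := moment alpha v.
have hk3 : (h + 3 <= k)%N by lia.
have low s : (2 <= s <= 2 * k - 2)%N -> m s = 0.
  move=> /(sum_avoiding_hook hk3)[i [j [ik jk ih jh ->]]].
  exact: self_orthogonal_moment so ik jk ih jh.
have hook_hi i : (i < k)%N -> i != h -> m (i + h)%N = 0 -> m (i + (k - 1 + t))%N = 0.
  move=> ik ih mih; have := self_orthogonal_moment_hook so ik ih.
  by rewrite -/m mih add0r => /eqP; rewrite mulf_eq0 (negbTE eta0) => /eqP.
have hook_lo i : (i < k)%N -> i != h -> m (i + (k - 1 + t))%N = 0 -> m (i + h)%N = 0.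
  move=> ik ih mi; have := self_orthogonal_moment_hook so ik ih.
  by rewrite -/m mi mulr0 addr0.
have m1 : m 1%N = 0.
  have [h2|h1] := leqP 2 h.
    by apply: (self_orthogonal_moment (i := 0) (j := 1) so); lia.
  have [h1'|h0] := eqVneq (h : nat) 1%N.
    have -> : 1%N = (0 + h)%N by lia.
    by apply: hook_lo; [lia | lia | apply: low; lia].
  (* Here [h = 0], and the relation for [i = 1] links [m 1] to [m (k + t)], which [low] covers only
     if [t < k - 1]. *)
  have [tk|tk] := ltnP t (k - 1).
    have -> : 1%N = (1 + h)%N by lia.
    by apply: hook_lo; [lia | lia | apply: low; lia].
  (* Now [t = k - 1], and [2 * k <= q <= 3 * k - 3] puts [q - (k - 1 + t)] between 2 and [k - 1]. *)
  rewrite /m -moment_card -/q -/m.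
  have -> : q = (q - (k - 1 + t) + (k - 1 + t))%N by lia.
  by apply: hook_hi; [lia | lia | apply: low; lia].
apply: (all_moments_eq0 _ ainj v0) => [|s /andP[s0 sn]]; first lia.
have [->//|s1] := eqVneq s 1%N.
have [sk|sk] := leqP s (2 * k - 2); first by apply: low; lia.
(* With [i = s - (k - 1 + t)], the bound on [q] gives [i < k], while [s > 2 * k - 2] and [hth] give
   [i > h]. So [i + h] lies in [1, 2k-2], where all moments are known to vanish. *)
have -> : s = (s - (k - 1 + t) + (k - 1 + t))%N by lia.
apply: hook_hi; [lia | lia |].
have [->//|s2] := eqVneq (s - (k - 1 + t) + h)%N 1%N.
by apply: low; lia.
Qed.
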